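(* If $N$ is a framenable group, $G$ is a countable group, and $\varphi:G\to N$ is a surjective group morphism, then $G$ is framenable.
   Context: ''Countable'' means countably infinite; groups are discrete. Hilbert spaces are complex and separable; $\mathcal U(H)$ is the group of unitary operators on $H$. A countable discrete group $G$ is framenable if there exist a unitary representation $\pi:G\to\mathcal U(H)$ with $1_G\prec\pi$, a countable (infinite) subset $S\subset G$, and a vector $v\in H$ such that $\{\pi_g v\}_{g\in S}$ is a weak frame. Here $1_G\prec\pi$ means that there is a net $(v_i)_{i\in I}$ of unit vectors in $H$ with $\|\pi_g v_i-v_i\|\to0$ for every $g\in G$. A family $\{f_n\}_{n\in S}$ in $H$ indexed by a countable set $S$ is a weak frame if $0<\sum_{n\in S}|\langle v,f_n\rangle|^2<\infty$ for every $v\in H$, $v\ne0$. *)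

(* Defs.v *)
From HB Require Import structures.
From mathcomp Require Import all_boot all_order all_algebra.
From mathcomp Require Import sesquilinear complex.
From mathcomp Require Import all_classical all_reals all_analysis.
Import Order.TTheory GRing.Theory Num.Theory.
Import numFieldNormedType.Exports.
Set Implicit Arguments.
Unset Strict Implicit.
Unset Printing Implicit Defensive.
Local Open Scope classical_set_scope.
Local Open Scope ring_scope.
Local Open Scope complex_scope.

(* Separability includes finite-dimensional spaces.  The form [inner] is linear
   in its first argument and conjugate-linear in the second. *)
Record hilbertSpace (R : realType) := HilbertSpace {
  hilbert_sort :> completeNormedModType R[i];
  inner : {dot hilbert_sort for Num.conj};
  inner_norm : forall x : hilbert_sort, inner x x = `|x| ^+ 2;
  hilbert_separable :
    exists2 D : set hilbert_sort, countable D & dense D }.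
Arguments inner {R} h.

Definition countably_infinite (T : Type) (A : set T) : Prop :=
  (A #= [set: nat])%card.

Definition unitary (R : realType) (H : hilbertSpace R) (u : {linear H -> H}) :
    Prop :=
  bijective u /\ isometry (inner H) (inner H) u.

Record unitary_rep (R : realType) (G : groupType) (H : hilbertSpace R) :=
  UnitaryRep {
    rep_op :> G -> {linear H -> H};
    rep_unitary : forall g, unitary (rep_op g);
    repM : forall g h, rep_op (g * h)%g =1 rep_op g \o rep_op h }.

Definition directed (I : Type) (le : I -> I -> Prop) : Prop :=
  [/\ inhabited I,
      forall i, le i i,
      forall i j k, le i j -> le j k -> le i k &
      forall i j, exists k, le i k /\ le j k].

Definition tails (I : Type) (le : I -> I -> Prop) : set_system I :=
  filter_from setT (fun i0 => [set i | le i0 i]).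

(* The library norm is [R[i]]-valued; the usual topology on the complex numbers
   is carried by the alias [R[i]^o]. *)
Definition weakly_contains_trivial (R : realType) (G : groupType)
    (H : hilbertSpace R) (pi : unitary_rep G H) : Prop :=
  exists (I : Type) (le : I -> I -> Prop) (v : I -> H),
    [/\ directed le,
        forall i, `|v i| = 1 &
        forall g, `|pi g (v i) - v i| @[i --> tails le] --> (0 : R[i]^o)].

(* [complex.Re] only reads the nonnegative real `|<v, f n>| ^+ 2 as an element
   of [R]. *)
Definition weak_frame (R : realType) (H : hilbertSpace R) (T : choiceType)
    (S : set T) (f : T -> H) : Prop :=
  forall v : H, v != 0 ->
    (0 < \esum_(n in S) (complex.Re (`|inner H v (f n)| ^+ 2))%:E < +oo)%E.

Definition framenable (R : realType) (G : groupType) : Prop :=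
  countably_infinite [set: G] /\
  exists (H : hilbertSpace R) (pi : unitary_rep G H) (S : set G) (v : H),
    [/\ weakly_contains_trivial pi,
        countably_infinite S &
        weak_frame S (fun g => pi g v)].

(* Main.v *)
Require Import Defs.
From mathcomp Require Import all_boot all_order all_algebra.
From mathcomp Require Import all_classical all_reals all_analysis.

(** Representations pull back along [phi], and each operator of the pulled-back
    representation is an operator of the original one.  A net of almost invariant
    unit vectors for [pi] is therefore almost invariant for [pi \o phi] as well.
    For the frame, let [s] be a set-theoretic section of [phi]: it is injective,
    so [s @` S] is again countably infinite, and since [pi (phi (s n)) v = pi n v]
    the family indexed by [s @` S] is the original family reindexed along the
    bijection [s : S -> s @` S].  Surjectivity of [phi] is what provides [s]. *)

Local Open Scope classical_set_scope.
Local Open Scope ring_scope.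

Section Pullback.
Variables (R : realType) (N G : groupType) (phi : {multiplicative G -> N}).
Variables (H : hilbertSpace R) (pi : unitary_rep N H).

Let pullbackM (g h : G) :
  pi (phi (g * h)%g) =1 pi (phi g) \o pi (phi h).
Proof. by move=> x; rewrite gmulfM repM. Qed.

Definition pullback_rep : unitary_rep G H :=
  @UnitaryRep R G H (fun g => pi (phi g)) (fun g => rep_unitary pi (phi g))
    pullbackM.

Lemma pullback_weakly_contains_trivial :
  weakly_contains_trivial pi -> weakly_contains_trivial pullback_rep.
Proof.
by move=> [I [le [v [dir v1 vinv]]]]; exists I, le, v; split=> // g; exact: vinv.
Qed.

End Pullback.

(** A weak frame only constrains a sum of nonnegative terms, and such a
    sum, being unconditional, is unchanged by a bijective reindexing. *)
Lemma weak_frame_reindex (R : realType) (H : hilbertSpace R)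
    (T U : choiceType) (S : set T) (S' : set U) (e : T -> U) (f : U -> H) :
  set_bij S S' e -> weak_frame S (f \o e) -> weak_frame S' f.
Proof.
move=> bij_e frame_fe v v0; rewrite (reindex_esum S _ e) //.
exact: frame_fe.
Qed.

Theorem proposition3p8 (R : realType) (N G : groupType)
    (phi : {multiplicative G -> N}) :
  framenable R N ->
  countably_infinite [set: G]%classic ->
  (forall y : N, exists x : G, phi x = y) ->
  framenable R G.
Proof.
move=> [_ [H [pi [S [v [triv_pi S_inf frame_v]]]]]] G_inf phi_surj.
split=> //.
have [s sK] := choice phi_surj.
have s_inj : injective s := can_inj sK.
exists H, (pullback_rep _ _ _ phi _ pi), (s @` S), v; split.
- exact: pullback_weakly_contains_trivial.
- apply: card_eq_trans S_inf.
  by apply: inj_card_eq => x y _ _; exact: s_inj.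
- apply: (weak_frame_reindex _ _ _ _ S _ s).
    by split=> [x Sx|x y _ _|//]; [exists x | exact: s_inj].
  suff -> : (fun g => pullback_rep _ _ _ phi _ pi g v) \o s = fun n => pi n v.
    by [].
  by apply/funext => n /=; rewrite sK.
Qed.
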